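(* Let $A$ be a unital $K$-algebra, where $K$ is a field that is an algebraic extension of a prime field $F$, and let $d$ be a derivation of the ring $A$. Then $d(K) = \{0\}$ and $d$ is a $K$-linear map.
   Context: A derivation of a ring $A$ is a map $d\colon A\to A$ with $d(a+b)=d(a)+d(b)$ and $d(ab)=d(a)b+a\,d(b)$ for all $a,b\in A$ (no linearity over $K$ is assumed). A prime field is $\mathbb{Q}$ or $\mathbb{F}_p$ for a prime $p$. Algebras are associative, and $K$ is identified with its image $K\cdot 1_A$ in $A$, which is central. *)

(* Defs.v *)
From HB Require Import structures.
From mathcomp Require Import all_boot all_order all_algebra.

Set Implicit Arguments.
Unset Strict Implicit.
Unset Printing Implicit Defensive.

Import GRing.Theory.
Local Open Scope ring_scope.

(* Prime fields are taken up to isomorphism.  In 'F_p, p must be prime: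
   otherwise 'F_p denotes the field of another characteristic. *)
Definition is_prime_field (F : fieldType) : Prop :=
  (exists f : {rmorphism rat -> F}, bijective f) \/
  (exists2 p : nat, prime p & exists f : {rmorphism 'F_p -> F}, bijective f).

Definition algebraic_extension (F K : fieldType) (iota : {rmorphism F -> K}) :
    Prop :=
  forall x : K, algebraicOver iota x.

(* MathComp's Derivation only covers linear endomorphisms of a field extension;
   here no linearity is assumed. *)
Definition is_derivation (A : pzRingType) (d : A -> A) : Prop :=
  (forall a b : A, d (a + b) = d a + d b) /\
  (forall a b : A, d (a * b) = d a * b + a * d b).

(* Main.v *)
Require Import Defs.
From HB Require Import structures.
From mathcomp Require Import all_boot all_order all_algebra.
From mathcomp Require Import finfield.

Import GRing.Theory.
Local Open Scope ring_scope.

(** Restricting [d] to [K] gives a derivation [D] of [K] with values in the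
    [K]-module [A], and Leibniz' rule [d (k a) = D k * a + k * d a] shows that
    [d] is linear as soon as [D] vanishes.  So everything is about derivations
    from a field to a module.

    Such a [D] kills the prime field [F]: in characteristic 0 because a rational
    is a quotient of integers, in characteristic [p] because [c = c ^+ p] there
    and [D (c ^+ p) = p c^(p-1) D c = 0].  Applying [D] to a relation [q(x) = 0]
    with coefficients in [F] therefore gives [q'(x) D x = 0]
    ([mder_horner]), so [D x = 0] once [x] is a simple root of some [q] over
    [F].  Such a [q] exists because prime fields are perfect
    ([simple_root]): take [q] nonzero of least degree vanishing at [x].  If
    [q'(x) = 0], then [q' = 0] by minimality; hence [q] is a polynomial in
    ['X^p], hence a [p]-th power, and its [p]-th root is a smaller polynomial
    vanishing at [x].

    All that the existence of [q] requires of [F] is that its Frobenius map be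
    the identity in positive characteristic; this also gives the [p]-th root, as
    [r(X^p) = r(X)^p] when the coefficients of [r] are their own [p]-th powers. *)

(** Vacuous in characteristic 0, which lets both kinds of prime fields be treated
    together. *)
Definition frobenius_trivial (F : fieldType) : Prop :=
  forall p, p \in [pchar F] -> forall c : F, c ^+ p = c.

Lemma deriv0_pchar {F : fieldType} {q : {poly F}} :
  q^`() = 0 -> (1 < size q)%N -> exists p, p \in [pchar F].
Proof.
move=> dq0 q_gt1.
have := coef_deriv q (size q).-2.
rewrite dq0 coef0 prednK; last by case: (size q) q_gt1 => [|[]].
move/esym/eqP; rewrite -mulr_natr mulf_eq0.
rewrite -[q`__]/(lead_coef q) lead_coef_eq0 -size_poly_eq0.
rewrite (gtn_eqF (ltnW q_gt1)) /=.
by case/natf0_pchar => [|p]; [case: (size q) q_gt1 => [|[]] | exists p].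
Qed.

Lemma deriv0_comp_Xp {F : fieldType} {p} {q : {poly F}} :
    p \in [pchar F] -> q^`() = 0 -> (1 < size q)%N ->
  exists2 r : {poly F}, (size r < size q)%N & q = r \Po 'X^p.
Proof.
move=> pcharF dq0 q_gt1; have p_gt1 := prime_gt1 (pcharf_prime pcharF).
exists (\poly_(i < (size q).-1) q`_(i * p)).
  by rewrite (leq_ltn_trans (size_poly _ _)) // prednK // ltnW.
apply/polyP => i; rewrite coef_comp_poly_Xn ?(ltnW p_gt1) //.
case: ifP => [/dvdnP[j ->] | p_ndvd_i]; last first.
  case: i p_ndvd_i => [|i]; first by rewrite dvdn0.
  rewrite (dvdn_pcharf pcharF) => i_neq0; apply/eqP.
  have /eqP := coef_deriv q i.
  by rewrite dq0 coef0 eq_sym -mulr_natr mulf_eq0 i_neq0 orbF.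
rewrite mulnK ?(ltnW p_gt1) // coef_poly; case: ltnP => // le_q_j.
(* As [j >= size q - 1 >= 1] and [p >= 2], the index [j p] exceeds the degree. *)
have j_gt0 : (0 < j)%N by apply: leq_trans le_q_j; rewrite -ltnS prednK // ltnW.
rewrite nth_default // -(prednK (ltnW q_gt1)) (leq_ltn_trans le_q_j) //.
exact: ltn_Pmulr.
Qed.

Lemma horner_frobenius {F K : fieldType} (iota : {rmorphism F -> K}) {p}
    (r : {poly F}) (x : K) :
    p \in [pchar F] -> frobenius_trivial F ->
  (map_poly iota r).[x ^+ p] = (map_poly iota r).[x] ^+ p.
Proof.
move=> pcharF frobF; have pcharK := rmorph_pchar iota pcharF.
rewrite -!(pFrobenius_autE pcharK) -horner_map; congr _.[_].
apply/polyP=> i; rewrite !coef_map /= pFrobenius_autE -rmorphXn.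
by rewrite (frobF p pcharF).
Qed.

(** Induction on the degree: the derivative of [q], and in the inseparable case
    its [p]-th root, provide the smaller polynomial vanishing at [x]. *)
Lemma simple_root {F K : fieldType} (iota : {rmorphism F -> K}) (x : K) :
    frobenius_trivial F -> algebraicOver iota x ->
  exists2 q : {poly F}, (map_poly iota q).[x] = 0
    & (map_poly iota q^`()).[x] != 0.
Proof.
move=> frobF [q]; have [n] := ubnP (size q).
elim: n => // n IHn in q *; rewrite ltnS => le_q_n q_neq0 qx0.
have q_gt1 : (1 < size q)%N.
  by rewrite -(size_map_poly iota) (root_size_gt1 _ qx0) // map_poly_eq0.
have [dqx0|] := eqVneq (map_poly iota q^`()).[x] 0; last first.
  by exists q; [apply/rootP|].
have [dq0|dq_neq0] := eqVneq q^`() 0; last first.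
  apply: (IHn q^`()) => //; last exact/rootP.
  by apply: leq_trans le_q_n; apply: lt_size_deriv.
have [p pcharF] := deriv0_pchar dq0 q_gt1.
have [r lt_r_q def_q] := deriv0_comp_Xp pcharF dq0 q_gt1.
apply: (IHn r); first exact: leq_trans lt_r_q le_q_n.
  by apply: contraNneq q_neq0 => r0; rewrite def_q r0 comp_poly0.
move: qx0; rewrite def_q map_comp_poly map_polyXn /root horner_comp hornerXn.
by rewrite (horner_frobenius _ _ _ pcharF) // expf_eq0 => /andP[].
Qed.

Section ModuleDerivation.

Variables (K : fieldType) (V : lmodType K) (D : K -> V).
Hypothesis DD : forall a b, D (a + b) = D a + D b.
Hypothesis DM : forall a b, D (a * b) = b *: D a + a *: D b.

Lemma mder0 : D 0 = 0.
Proof. by apply: (addrI (D 0)); rewrite -DD !addr0. Qed.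

Lemma mder1 : D 1 = 0.
Proof. by apply: (addrI (D 1)); rewrite -{1 2}[D 1]scale1r -DM mulr1 addr0. Qed.

Lemma mder_int (m : int) : D m%:~R = 0.
Proof.
have mder_nat n : D n%:R = 0.
  by elim: n => [|n IHn]; rewrite ?mder0 // -natr1 DD IHn mder1 addr0.
case: m => n; rewrite ?NegzE ?mulrNz -pmulrn //.
by apply: (addrI (D n.+1%:R)); rewrite -DD subrr mder0 mder_nat addr0.
Qed.

Lemma mderX x n : D (x ^+ n) = x ^+ n.-1 *: D x *+ n.
Proof.
elim: n => [|[|n] IHn]; first by rewrite mder1.
  by rewrite expr1 scale1r.
rewrite exprS DM IHn -scalerMnr scalerA -exprS [in RHS]mulrS.
by rewrite scalerMnr.
Qed.

(** The chain rule: the coefficients of [q] behave as constants for [D], so only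
    the derivative of [q] contributes. *)
Lemma mder_horner (F : fieldType) (iota : {rmorphism F -> K}) x q :
    (forall c, D (iota c) = 0) ->
  D (map_poly iota q).[x] = (map_poly iota q^`()).[x] *: D x.
Proof.
move=> Diota; elim/poly_ind: q => [|q c IHq].
  by rewrite deriv0 !rmorph0 !horner0 mder0 scale0r.
rewrite derivMXaddC !rmorphD !rmorphM /= map_polyX map_polyC !hornerE /=.
by rewrite DD Diota addr0 DM IHq scalerA scalerDl addrC mulrC.
Qed.

Lemma mder_algebraic (F : fieldType) (iota : {rmorphism F -> K}) :
    frobenius_trivial F -> (forall c, D (iota c) = 0) ->
  forall x, algebraicOver iota x -> D x = 0.
Proof.
move=> frobF Diota x /(simple_root _ _ frobF)[q qx0 dqx_neq0].
have /esym/eqP := mder_horner _ _ x q Diota.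
by rewrite qx0 mder0 scaler_eq0 (negPf dqx_neq0) => /eqP.
Qed.

Lemma mder_frobenius_trivial (F : fieldType) (iota : {rmorphism F -> K}) p :
  p \in [pchar F] -> frobenius_trivial F -> forall c, D (iota c) = 0.
Proof.
move=> pcharF frobF c; rewrite -(frobF p pcharF c) rmorphXn mderX.
by rewrite -scaler_nat (pcharf0 (rmorph_pchar iota pcharF)) scale0r.
Qed.

Lemma mder_rat (f : {rmorphism rat -> K}) r : D (f r) = 0.
Proof.
have den_neq0 : (denq r)%:~R != 0 :> K.
  by rewrite -(rmorph_int f) fmorph_eq0 intr_eq0 denq_neq0.
have := mder_int (numq r); rewrite -(rmorph_int f) numqE rmorphM rmorph_int.
rewrite DM mder_int scaler0 addr0 => /eqP.
by rewrite scaler_eq0 (negPf den_neq0) => /eqP.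
Qed.

End ModuleDerivation.

Lemma prime_field_frobenius {F : fieldType} :
  is_prime_field F -> frobenius_trivial F.
Proof.
case=> [[f _] p | [p p_pr [f [g _ gK]]] p'].
  by rewrite (fmorph_pchar f) Num.Theory.pchar_num.
rewrite (fmorph_pchar f) (pcharf_eq (pchar_Fp p_pr)) => /eqP-> c.
have := expf_card (g c); rewrite card_Fp // => gc_p.
by rewrite -(gK c) -rmorphXn /= gc_p.
Qed.

Lemma mder_prime_field {F K : fieldType} (iota : {rmorphism F -> K})
    {V : lmodType K} {D : K -> V} :
    is_prime_field F ->
    (forall a b, D (a + b) = D a + D b) ->
    (forall a b, D (a * b) = b *: D a + a *: D b) ->
  forall c, D (iota c) = 0.
Proof.
move=> primeF DD DM; have frobF := prime_field_frobenius primeF.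
case: primeF => [[f [g _ gK]] c | [p p_pr [f _]]].
  by rewrite -(gK c); apply: (mder_rat _ _ _ DD DM (iota \o f)).
apply: (mder_frobenius_trivial _ _ _ DM _ _ p) => //.
by rewrite (fmorph_pchar f) pchar_Fp.
Qed.

Theorem theorem2p2 (F K : fieldType) (iota : {rmorphism F -> K})
    (primeF : is_prime_field F) (algK : algebraic_extension iota)
    (A : algType K) (d : A -> A) (derd : is_derivation d) :
  (forall k : K, d k%:A = 0) /\ linear d.
Proof.
case: derd => dD dM.
have DD (a b : K) : d (a + b)%:A = d a%:A + d b%:A by rewrite scalerDl dD.
have DM (a b : K) : d (a * b)%:A = b *: d a%:A + a *: d b%:A.
  by rewrite -scalerA -mulr_algl dM mulr_algr mulr_algl.
have dK k : d k%:A = 0.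
  apply: (mder_algebraic _ _ (fun a : K => d a%:A) DD DM F iota) => //.
    exact: prime_field_frobenius.
  exact: (mder_prime_field iota primeF DD DM).
split=> // a u v.
by rewrite dD -[a *: u]mulr_algl dM dK mul0r add0r mulr_algl.
Qed.
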